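(* Let $F$ be a field and let $A$ be an $F$-algebra (not necessarily associative, commutative or unital) which is generated as an algebra by two primitive axes $a$ and $b$, where $a$ is of type $(\lambda,\delta)$ and $b$ is of type $(\lambda',\delta')$, with $\lambda,\delta,\lambda',\delta'\in F\setminus\{0,1\}$. Then $\dim_F(A)\le 5$.
   Context: For $a\in A$ let $L_a(x)=ax$ and $R_a(x)=xa$ $(x\in A)$. For $\mu\in F$ put $A_\mu(L_a)=\{v\in A: av=\mu v\}$ and $A_\mu(R_a)=\{v\in A: va=\mu v\}$; these may be $0$. Let $\lambda,\delta\in F\setminus\{0,1\}$. An idempotent $a\in A$ ($a^2=a$) is a primitive axis of type $(\lambda,\delta)$ if all of the following hold: (1) $(L_a-\lambda)(L_a-1)L_a=0$, $A_1(L_a)=Fa$, and the decomposition $A=A^+\oplus A^-$ with $A^+=Fa\oplus A_0(L_a)$, $A^-=A_\lambda(L_a)$ is a $\mathbb{Z}_2$-grading (i.e. $A^+A^+\subseteq A^+$, $A^+A^-\subseteq A^-$, $A^-A^+\subseteq A^-$, $A^-A^-\subseteq A^+$); (2) $(R_a-\delta)(R_a-1)R_a=0$, $A_1(R_a)=Fa$, and the decomposition $A=(Fa\oplus A_0(R_a))\oplus A_\delta(R_a)$ is likewise a $\mathbb{Z}_2$-grading with even part $Fa\oplus A_0(R_a)$ and odd part $A_\delta(R_a)$; (3) $L_aR_a=R_aL_a$. *)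

(* Defs.v *)
From mathcomp Require Import all_boot all_algebra.
From mathcomp Require Import boolp classical_sets.

Set Implicit Arguments.
Unset Strict Implicit.
Unset Printing Implicit Defensive.

Import GRing.Theory.
Local Open Scope ring_scope.
Local Open Scope classical_set_scope.

(* An algebra over F (not assumed associative, commutative, unital or
   finite-dimensional) is an F-vector space A with a bilinear product
   mul : {bilinear A -> A -> A}. The definitions below only need the underlying
   function of mul. *)

Section NonassociativeAlgebra.
Variables (F : fieldType) (A : lmodType F).

Definition line (a : A) : set A := [set v | exists k : F, v = k *: a].

Definition sumset (U V : set A) : set A :=
  [set x | exists u v, [/\ U u, V v & x = u + v]].

Definition is_direct_sum (U V W : set A) : Prop :=
  U `&` V = [set 0] /\ W = sumset U V.

Definition eigenset (T : A -> A) (mu : F) : set A := [set v | T v = mu *: v].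

Definition op_sub (T : A -> A) (mu : F) : A -> A := fun v => T v - mu *: v.

Definition is_basis (m : nat) (e : 'I_m -> A) : Prop :=
  (forall c : 'I_m -> F, \sum_(i < m) c i *: e i = 0 -> forall i, c i = 0) /\
  (forall x : A, exists c : 'I_m -> F, x = \sum_(i < m) c i *: e i).

Definition dim_le (n : nat) : Prop :=
  exists (m : nat) (e : 'I_m -> A), is_basis e /\ (m <= n)%N.

Section Product.
Variable mul : A -> A -> A.

Definition Lmul (a : A) : A -> A := fun x => mul a x.
Definition Rmul (a : A) : A -> A := fun x => mul x a.

Definition is_subalgebra (S : set A) : Prop :=
  [/\ S 0,
      forall x y, S x -> S y -> S (x + y),
      forall (k : F) x, S x -> S (k *: x)
    & forall x y, S x -> S y -> S (mul x y)].

Definition subalgebra_generated (X : set A) : set A :=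
  [set x | forall S : set A, is_subalgebra S -> X `<=` S -> S x].

Definition mul_sub (U V W : set A) : Prop :=
  forall u v, U u -> V v -> W (mul u v).

Definition Z2_grading (Ev Od : set A) : Prop :=
  [/\ is_direct_sum Ev Od [set: A],
      mul_sub Ev Ev Ev, mul_sub Ev Od Od, mul_sub Od Ev Od & mul_sub Od Od Ev].

(* T stands for either L_a or R_a; in both cases the grading is with respect to
   the product mul itself. *)
Definition axis_condition (a : A) (T : A -> A) (mu : F) : Prop :=
  [/\ forall x, op_sub T mu (op_sub T 1 (T x)) = 0,
      eigenset T 1 = line a
    & exists2 Ev : set A,
        is_direct_sum (line a) (eigenset T 0) Ev
      & Z2_grading Ev (eigenset T mu)].

Definition primitive_axis (a : A) (lambda delta : F) : Prop :=
  [/\ mul a a = a,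
      axis_condition a (Lmul a) lambda,
      axis_condition a (Rmul a) delta
    & forall x, Lmul a (Rmul a x) = Rmul a (Lmul a x)].

End Product.
End NonassociativeAlgebra.

(* Main.v *)
Require Import Defs.
From mathcomp Require Import all_boot all_algebra.
From mathcomp Require Import boolp classical_sets.

Set Implicit Arguments.
Unset Strict Implicit.
Unset Printing Implicit Defensive.

Import GRing.Theory.
Local Open Scope ring_scope.
Local Open Scope classical_set_scope.

(* For T = L_a or R_a, (T - mu) T v lies on the line of a, so
   V = span(a, b, ab, ba, aba) is stable under L_a and R_a, hence under the
   projections of the two gradings of a. Let p be the L_a-odd part of b and b_e
   its even part. As (ab)b lies in span(ab, b), the product pb lies in V, and so
   do its components p b_e and p p; the odd part of b b = b reads
   p = p b_e + b_e p, whence bp and then bab lie in V. By symmetry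
   V = span(b, a, ba, ab, bab), so V is also stable under L_b and R_b. Finally, if
   u V is contained in V, comparing components shows the same for au and ua;
   starting from a and b, this makes V a subalgebra. *)

(** * Submodules, spans and spanning families *)

Section Submodules.
Variables (F : fieldType) (A : lmodType F).
Implicit Types (S : set A) (s : seq A) (u v : A).

Definition is_submodule S :=
  [/\ S 0, forall u v, S u -> S v -> S (u + v)
    & forall (k : F) u, S u -> S (k *: u)].

Lemma submoduleB S u v : is_submodule S -> S u -> S v -> S (u - v).
Proof.
by case=> _ SD SZ Su Sv; rewrite -scaleN1r; apply: SD => //; apply: SZ.
Qed.

Lemma submodule_unscale S (k : F) v :
  is_submodule S -> k != 0 -> S (k *: v) -> S v.
Proof.
case=> _ _ SZ k0 Skv; rewrite -[v]scale1r -(mulVf k0) -scalerA.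
exact: SZ.
Qed.

Lemma submodule_addr S u v : is_submodule S -> S u -> S (u + v) -> S v.
Proof.
by move=> mS Su Suv; rewrite -(addKr u v) addrC; apply: submoduleB.
Qed.

Lemma submodule_preim (f : A -> A) S :
  linear f -> is_submodule S -> is_submodule [set v | S (f v)].
Proof.
move=> lf [S0 SD SZ].
have fD u v : f (u + v) = f u + f v by have := lf 1 u v; rewrite !scale1r.
have f0 : f 0 = 0 by apply: (addIr (f 0)); rewrite -fD !add0r.
have fZ k u : f (k *: u) = k *: f u by have := lf k u 0; rewrite !addr0 f0 addr0.
by split=> /= [|u v|k u]; rewrite ?f0 ?fD ?fZ; auto.
Qed.

(** Coefficients are indexed by positions, so the listed vectors may coincide or be dependent. *)
Definition span s : set A :=
  [set v | exists c : 'I_(size s) -> F, v = \sum_i c i *: s`_i].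

Lemma span_submodule s : is_submodule (span s).
Proof.
split=> [|u v [c ->] [d ->]|k u [c ->]].
- by exists (fun=> 0); rewrite big1 // => i _; rewrite scale0r.
- exists (fun i => c i + d i); rewrite -big_split.
  by apply: eq_bigr => i _; rewrite scalerDl.
- exists (fun i => k * c i); rewrite scaler_sumr.
  by apply: eq_bigr => i _; rewrite scalerA.
Qed.

Lemma mem_span s v : v \in s -> span s v.
Proof.
move=> vs; have lt_v : (index v s < size s)%N by rewrite index_mem.
exists (fun i => (i == Ordinal lt_v)%:R).
rewrite (bigD1 (Ordinal lt_v)) //= eqxx scale1r nth_index // big1 ?addr0 //.
by move=> i /negPf ->; rewrite scale0r.
Qed.

Lemma span_sub s S :
  is_submodule S -> (forall v, v \in s -> S v) -> span s `<=` S.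
Proof.
case=> S0 SD SZ sS _ [c ->]; apply: (big_ind S) => // i _.
by apply: SZ; apply: sS; rewrite mem_nth.
Qed.

Lemma dim_le_spanning n (e : 'I_n -> A) :
  (forall x, exists c : 'I_n -> F, x = \sum_i c i *: e i) -> dim_le A n.
Proof.
elim: n e => [|n IHn] e spe.
  by exists 0, e; split=> //; split=> // c _ [].
have [free_e|] :=
  pselect (forall c : 'I_n.+1 -> F, \sum_i c i *: e i = 0 -> forall i, c i = 0).
  by exists n.+1, e.
move=> /existsNP[c /not_implyP[c0 /existsNP[i /eqP ci0]]].
have [|m [e' [be' lem]]] := IHn (fun j => e (lift i j)).
  move=> x; have [d xE] := spe x.
  exists (fun j => d (lift i j) - d i / c i * c (lift i j)).
  have {xE} : x = \sum_j (d j - d i / c i * c j) *: e j.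
    under eq_bigr do rewrite scalerBl -scalerA.
    by rewrite sumrB -scaler_sumr c0 scaler0 subr0.
  by rewrite (bigD1_ord i) //= mulfVK // subrr scale0r add0r.
by exists m, e'; split=> //; apply: leqW.
Qed.

End Submodules.

(** * Multiplication operators of an axis and their gradings *)

Section Axes.
Variables (F : fieldType) (A : lmodType F) (mul : {bilinear A -> A -> A}).
Implicit Types (S : set A) (T : A -> A) (u v : A) (mu : F).

Let mulDl u v w : mul (u + v) w = mul u w + mul v w.
Proof. exact: linearDl. Qed.
Let mulDr u v w : mul w (u + v) = mul w u + mul w v.
Proof. exact: linearDr. Qed.
Let mulZl k u v : mul (k *: u) v = k *: mul u v.
Proof. exact: linearZl_LR. Qed.
Let mulZr k u v : mul u (k *: v) = k *: mul u v.
Proof. exact: linearZr_LR. Qed.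

Lemma Lmul_linear u : linear (Lmul mul u).
Proof. by move=> k v w; rewrite /Lmul mulDr mulZr. Qed.

Lemma Rmul_linear u : linear (Rmul mul u).
Proof. by move=> k v w; rewrite /Rmul mulDl mulZl. Qed.

(* The even part [line a + eigenset T 0] of the axis condition, rewritten as the
   preimage of the line. *)
Definition even_set a T : set A := [set v | line a (T v)].

Record axial_operator a T mu : Prop := AxialOperator {
  axial_linear : linear T;
  axial_fixed : T a = a;
  axial_grading : Z2_grading mul (even_set a T) (eigenset T mu) }.

(** If [T v = k *: a], then [T a = a] gives [T (v - k *: a) = 0]; hence the preimage of the line is
    the line plus the kernel. *)
Lemma axis_operator a T mu :
  linear T -> axis_condition mul a T mu -> axial_operator a T mu.
Proof.
move=> lT [_ T1 [Ev [_ EvE] gr]].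
have Ta : T a = a.
  have : line a a by exists 1; rewrite scale1r.
  by rewrite -T1 /eigenset /= scale1r.
suff EvT : Ev = even_set a T by split=> //; rewrite -EvT.
rewrite EvE; apply/seteqP; split=> v /=.
  by case=> _ [w [[k ->] Tw ->]]; exists k; rewrite lT Ta Tw scale0r addr0.
case=> k Tv; exists (k *: a), (v - k *: a); split; first by exists k.
- by rewrite /eigenset /= addrC -scaleNr lT Ta Tv scaleNr addNr scale0r.
- by rewrite addrC subrK.
Qed.

Section AxialOperatorTheory.
Variables (a : A) (T : A -> A) (mu : F).
Hypothesis axT : axial_operator a T mu.

Let TD u v : T (u + v) = T u + T v.
Proof. by have := axial_linear axT 1 u v; rewrite !scale1r. Qed.

Let T0 : T 0 = 0.
Proof. by apply: (addIr (T 0)); rewrite -TD !add0r. Qed.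

Let TZ k u : T (k *: u) = k *: T u.
Proof. by have := axial_linear axT k u 0; rewrite !addr0 T0 addr0. Qed.

Lemma line_submodule : is_submodule (line a).
Proof.
split=> [|_ _ [k ->] [l ->]|k _ [l ->]].
- by exists 0; rewrite scale0r.
- by exists (k + l); rewrite scalerDl.
- by exists (k * l); rewrite scalerA.
Qed.

Lemma even_submodule : is_submodule (even_set a T).
Proof. exact: submodule_preim (axial_linear axT) line_submodule. Qed.

Lemma odd_submodule : is_submodule (eigenset T mu).
Proof.
split=> [|u v Tu Tv|k u Tu]; rewrite /eigenset /=.
- by rewrite T0 scaler0.
- by rewrite TD Tu Tv scalerDr.
- by rewrite TZ Tu !scalerA mulrC.
Qed.

Lemma axial_decomp v : exists e o (k : F),
  [/\ even_set a T e, eigenset T mu o, v = e + o & T v = k *: a + mu *: o].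
Proof.
have [[_ gT] _ _ _ _] := axial_grading axT.
have : [set: A] v by [].
rewrite gT => -[e [o [Ee Oo ->]]].
by have [k Te] := Ee; exists e, o, k; split=> //; rewrite TD Te Oo.
Qed.

(** From [T v = k *: a + mu *: o], a second application only rescales the odd term by [mu]; the
    defect is a multiple of [a]. *)
Lemma axial_sqr v : exists k : F, T (T v) = mu *: T v + k *: a.
Proof.
have [e [o [k [_ Oo _ ->]]]] := axial_decomp v; exists (k - mu * k).
rewrite TD !TZ (axial_fixed axT) Oo scalerBl scalerDr !scalerA.
by rewrite [RHS]addrC addrA subrK.
Qed.

Hypotheses (mu0 : mu != 0) (mu1 : mu != 1).
Variable S : set A.
Hypotheses (mS : is_submodule S) (ST : forall v, S v -> S (T v)).

(* [(T T - T) (e + o) = mu (mu - 1) o] *)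
Lemma axial_stable_split e o :
  even_set a T e -> eigenset T mu o -> S (e + o) -> S e /\ S o.
Proof.
move=> [k Te] Oo Seo.
have So : S o.
  apply: (submodule_unscale (k := mu * mu - mu) mS).
    by rewrite -{3}[mu]mulr1 -mulrBr mulf_neq0 // subr_eq0.
  have := submoduleB mS (ST (ST Seo)) (ST Seo).
  rewrite !TD Te Oo !TZ (axial_fixed axT) Oo.
  by rewrite scalerA opprD addrACA subrr add0r -scalerBl.
by split=> //; rewrite -(addrK o e); apply: submoduleB.
Qed.

(** Since [T u = k *: a + mu *: o] with [o] the odd part of [u], it suffices to treat [o]. For
    [v = e' + o'], the product [o e'] is the odd part of [u e'] and [o o'] is the even part of
    [u o']. *)
Lemma axial_absorb u :
  (forall v, S v -> S (mul a v)) -> (forall v, S v -> S (mul u v)) ->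
  forall v, S v -> S (mul (T u) v).
Proof.
move=> Sa Su v Sv; have [_ SD SZ] := mS.
have [_ gEE gEO gOE gOO] := axial_grading axT.
have [e [o [k [Ee Oo uE ->]]]] := axial_decomp u.
rewrite mulDl !mulZl; apply: (SD); apply: SZ; first exact: Sa.
have [e' [o' [_ [Ee' Oo' vE _]]]] := axial_decomp v.
have [Se' So'] : S e' /\ S o'.
  by apply: axial_stable_split => //; rewrite -vE.
have [_ Soe'] : S (mul e e') /\ S (mul o e').
  by apply: axial_stable_split; auto; rewrite -mulDl -uE; apply: Su.
have [Soo' _] : S (mul o o') /\ S (mul e o').
  by apply: axial_stable_split; auto; rewrite -mulDl addrC -uE; apply: Su.
by rewrite vE mulDr; apply: SD.
Qed.

End AxialOperatorTheory.

(** * The span of a, b, ab, ba, aba *)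

Section AxisPair.
Variables (a b : A) (la de la' de' : F).
Hypotheses (la0 : la != 0) (la1 : la != 1).
Hypotheses (ha : primitive_axis mul a la de) (hb : primitive_axis mul b la' de').

Let axLa : axial_operator a (Lmul mul a) la.
Proof. by case: ha => _ hL _ _; apply: axis_operator hL; apply: Lmul_linear. Qed.

Let axRa : axial_operator a (Rmul mul a) de.
Proof. by case: ha => _ _ hR _; apply: axis_operator hR; apply: Rmul_linear. Qed.

Let axRb : axial_operator b (Rmul mul b) de'.
Proof. by case: hb => _ _ hR _; apply: axis_operator hR; apply: Rmul_linear. Qed.

Definition pair_span := span [:: a; b; mul a b; mul b a; mul a (mul b a)].

Lemma pair_span_submodule : is_submodule pair_span.
Proof. exact: span_submodule. Qed.

(** The generators ab and a(ba) are already images under [L_a], so [axial_sqr] brings their next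
    images back. *)
Lemma pair_span_stableL v : pair_span v -> pair_span (mul a v).
Proof.
have [aa _ _ _] := ha; have [_ SD SZ] := pair_span_submodule.
have sqr u : pair_span (mul a u) -> pair_span (mul a (mul a u)).
  have [k] := axial_sqr axLa u; rewrite /Lmul => -> Su.
  by apply: (SD); apply: SZ => //; apply: mem_span; rewrite mem_head.
apply: (span_sub (S := [set u | pair_span (mul a u)])) => {v} [|v].
  exact: submodule_preim (Lmul_linear a) pair_span_submodule.
rewrite !inE => /or4P[/eqP ->|/eqP ->|/eqP ->|/orP[] /eqP ->] /=.
- by rewrite aa; apply: mem_span; rewrite !inE eqxx.
- by apply: mem_span; rewrite !inE eqxx ?orbT.
- by apply: sqr; apply: mem_span; rewrite !inE eqxx ?orbT.
- by apply: mem_span; rewrite !inE eqxx ?orbT.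
- by apply: sqr; apply: mem_span; rewrite !inE eqxx ?orbT.
Qed.

(** As [L_a] and [R_a] commute, a(ba) = (ab)a is also an image under [R_a], so one generator aba
    serves both sides. *)
Lemma pair_span_stableR v : pair_span v -> pair_span (mul v a).
Proof.
have [aa _ _ aLR] := ha; have [_ SD SZ] := pair_span_submodule.
have aba u : mul a (mul u a) = mul (mul a u) a by exact: aLR.
have sqr u : pair_span (mul u a) -> pair_span (mul (mul u a) a).
  have [k] := axial_sqr axRa u; rewrite /Rmul => -> Su.
  by apply: (SD); apply: SZ => //; apply: mem_span; rewrite mem_head.
apply: (span_sub (S := [set u | pair_span (mul u a)])) => {v} [|v].
  exact: submodule_preim (Rmul_linear a) pair_span_submodule.
rewrite !inE => /or4P[/eqP ->|/eqP ->|/eqP ->|/orP[] /eqP ->] /=.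
- by rewrite aa; apply: mem_span; rewrite !inE eqxx.
- by apply: mem_span; rewrite !inE eqxx ?orbT.
- by apply: mem_span; rewrite -aba !inE eqxx ?orbT.
- by apply: sqr; apply: mem_span; rewrite !inE eqxx ?orbT.
- by rewrite aba; apply: sqr; apply: mem_span; rewrite -aba !inE eqxx ?orbT.
Qed.

Lemma pair_span_bab : pair_span (mul b (mul a b)).
Proof.
have mS := pair_span_submodule; have [_ SD SZ] := mS.
have [bb _ _ _] := hb.
have [_ gEE gEO gOE gOO] := axial_grading axLa.
have split_stable := axial_stable_split axLa la0 la1 mS pair_span_stableL.
have Sb : pair_span b by apply: mem_span; rewrite !inE eqxx ?orbT.
have Sba : pair_span (mul b a) by apply: mem_span; rewrite !inE eqxx ?orbT.
have Sab : pair_span (mul a b) by apply: mem_span; rewrite !inE eqxx ?orbT.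
have Sabb : pair_span (mul (mul a b) b).
  have [k] := axial_sqr axRb a; rewrite /Rmul => ->.
  by apply: SD; apply: SZ.
have [e [p [k [Ee Op bE]]]] := axial_decomp axLa b.
rewrite /Lmul => abE; have [Se Sp] : pair_span e /\ pair_span p.
  by apply: split_stable => //; rewrite -bE.
have Spb : pair_span (mul p b).
  apply: (submodule_unscale mS la0); rewrite -mulZl.
  have -> : la *: p = - k *: a + mul a b by rewrite abE scaleNr addKr.
  by rewrite mulDl mulZl; apply: SD => //; apply: SZ.
have [Spp Spe] : pair_span (mul p p) /\ pair_span (mul p e).
  by apply: split_stable; auto; rewrite -mulDr addrC -bE.
have Sep : pair_span (mul e p).
  have mE := even_submodule axLa; have mO := odd_submodule axLa.
  have [_ ED _] := mE; have [_ OD _] := mO.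
  (* These are the even and odd parts of bb - b; their sum is 0, so the splitting applies to it. *)
  have [] : pair_span (mul e e + mul p p - e) /\
            pair_span (mul p e + mul e p - p).
    apply: split_stable.
    - by apply: (submoduleB mE) => //; apply: ED; [apply: gEE | apply: gOO].
    - by apply: (submoduleB mO) => //; apply: OD; [apply: gOE | apply: gEO].
    rewrite addrACA -opprD -bE [mul p e + _]addrC addrACA.
    rewrite -mulDr [mul p p + _]addrC -mulDr -bE -mulDl -bE bb subrr.
    by case: mS.
  by move=> _ /(SD _ _ Sp); rewrite addrC subrK => /(submodule_addr mS Spe).
(* b(ab) = k ba + [la] bp, and bp = ep + pp. *)
rewrite abE mulDr !mulZr; apply: (SD); apply: SZ => //.
by rewrite bE mulDl; apply: SD.
Qed.

End AxisPair.

(** Only the generator b(ab) is not already listed in [pair_span a b]. *)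
Lemma pair_span_swap a b la de la' de' : la != 0 -> la != 1 ->
  primitive_axis mul a la de -> primitive_axis mul b la' de' ->
  pair_span b a `<=` pair_span a b.
Proof.
move=> la0 la1 ha hb; apply: span_sub => [|v]; first exact: pair_span_submodule.
rewrite !inE => /or4P[/eqP ->|/eqP ->|/eqP ->|/orP[] /eqP ->].
5: exact: pair_span_bab ha hb.
all: by apply: mem_span; rewrite !inE eqxx ?orbT.
Qed.

End Axes.

(** * Closure of the span under the product *)

Theorem theoremA (F : fieldType) (A : lmodType F) (mul : {bilinear A -> A -> A})
    (a b : A) (lambda delta lambda' delta' : F)
    (hl0 : lambda != 0) (hl1 : lambda != 1)
    (hd0 : delta != 0) (hd1 : delta != 1)
    (hl0' : lambda' != 0) (hl1' : lambda' != 1)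
    (hd0' : delta' != 0) (hd1' : delta' != 1)
    (ha : primitive_axis mul a lambda delta)
    (hb : primitive_axis mul b lambda' delta')
    (hgen : subalgebra_generated mul [set a; b] = [set: A]) :
  dim_le A 5.
Proof.
have sba := pair_span_swap hl0 hl1 ha hb.
have sab := pair_span_swap hl0' hl1' hb ha.
pose S := pair_span mul a b.
have mS : is_submodule S by exact: pair_span_submodule.
have SLa := pair_span_stableL (b := b) ha.
have SRa := pair_span_stableR (b := b) ha.
have SLb v : S v -> S (mul b v).
  (* Both inclusions identify [S] with [pair_span b a], which is stable under [L_b]. *)
  by move=> /sab Sv; apply: sba; apply: pair_span_stableL hb _ Sv.
have axLa : axial_operator mul a (Lmul mul a) lambda.
  by case: ha => _ hL _ _; apply: axis_operator hL; apply: Lmul_linear.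
have axRa : axial_operator mul a (Rmul mul a) delta.
  by case: ha => _ _ hR _; apply: axis_operator hR; apply: Rmul_linear.
have absorbL u := axial_absorb axLa hl0 hl1 mS SLa (u := u) SLa.
have absorbR u := axial_absorb axRa hd0 hd1 mS SRa (u := u) SLa.
have Smul u v : S u -> S v -> S (mul u v).
  move=> Su Sv; move: u Su.
  (* With [v] fixed, only the five generators need checking as left factors; ab, ba and a(ba) are
     reached from b by [L_a] and [R_a]. *)
  apply: (span_sub (S := [set u | S (mul u v)])) => [|u].
    exact: submodule_preim (Rmul_linear mul v) mS.
  rewrite !inE => /or4P[/eqP ->|/eqP ->|/eqP ->|/orP[] /eqP ->] /=.
  - exact: SLa.
  - exact: SLb.
  - exact: absorbL SLb _ Sv.
  - exact: absorbR SLb _ Sv.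
  - exact: absorbL (absorbR _ SLb) _ Sv.
have St x : S x.
  have : [set: A] x by [].
  rewrite -hgen; apply; first by case: mS.
  by move=> y [] ->; apply: mem_span; rewrite !inE eqxx ?orbT.
exact: dim_le_spanning St.
Qed.
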